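(* For every integer $m\ge 3$, $\omega_0(C_m)=\left\lceil \frac{m(m+1)}{4}\right\rceil$, where $C_m$ is the cycle with $m$ vertices.
   Context: The cycle $C_m$ is the graph with vertices $v_1,\dots,v_m$ and edges $\{v_i,v_{i+1}\}$ for $1\le i\le m$, with $v_{m+1}=v_1$, regarded as a hypergraph $(\mathcal V,\mathcal E)$ whose hyperedges are its edges. An edge-discriminator on a hypergraph $\mathcal H=(\mathcal V,\mathcal E)$ is a function $\lambda:\mathcal V\to\mathbb Z^{+}\cup\{0\}$ such that $\sum_{v\in E}\lambda(v)>0$ for every $E\in\mathcal E$, and $\sum_{v\in E}\lambda(v)\ne\sum_{v\in E'}\lambda(v)$ for every two distinct $E,E'\in\mathcal E$. Its weight is $\omega_\lambda(\mathcal V)=\sum_{v\in\mathcal V}\lambda(v)$. The quantity $\omega_0(\mathcal H)$ is the minimum of $\omega_\lambda(\mathcal V)$ over all edge-discriminators $\lambda$ on $\mathcal H$. *)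

(* Defs.v *)
From mathcomp Require Import all_boot.
From mathcomp Require Import boolp.

Set Implicit Arguments.
Unset Strict Implicit.
Unset Printing Implicit Defensive.

(* Hyperedges are required to be nonempty: a hypergraph with an empty hyperedge
   has no edge-discriminator, hence no minimum weight. *)
Record hypergraph (V : finType) := Hypergraph {
  hyperedges : {set {set V}};
  hyperedges_neq0 : set0 \notin hyperedges
}.

Definition edge_discriminator (V : finType) (H : hypergraph V)
    (lambda : V -> nat) : Prop :=
  (forall E : {set V}, E \in hyperedges H -> 0 < \sum_(v in E) lambda v) /\
  (forall E E' : {set V}, E \in hyperedges H -> E' \in hyperedges H ->
     E <> E' -> \sum_(v in E) lambda v <> \sum_(v in E') lambda v).

Definition weight (V : finType) (lambda : V -> nat) : nat :=
  \sum_(v : V) lambda v.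

Definition discriminator_weight (V : finType) (H : hypergraph V) (w : nat) :
    Prop :=
  exists2 lambda : V -> nat, edge_discriminator H lambda & weight lambda = w.

Lemma binary_sum_inj (n : nat) (f g : nat -> bool) :
  \sum_(i < n) f i * 2 ^ i = \sum_(i < n) g i * 2 ^ i ->
  forall i, i < n -> f i = g i.
Proof.
elim: n f g => [|n IHn] f g //.
have shift (h : nat -> bool) :
    \sum_(i < n.+1) h i * 2 ^ i = h 0 + (\sum_(i < n) h i.+1 * 2 ^ i).*2.
  rewrite big_ord_recl expn0 muln1 -muln2 big_distrl /=; congr (_ + _).
  by apply: eq_bigr => i _; rewrite /bump add1n expnSr mulnA.
rewrite !shift => eq_fg.
have eq0 : f 0 = g 0.
  by move/(congr1 odd): eq_fg; rewrite !oddD !odd_double !addbF !oddb.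
move: eq_fg; rewrite eq0 => /addnI/double_inj eq_tl [|i] // lt_in.
exact: (IHn (fun j => f j.+1) (fun j => g j.+1) eq_tl).
Qed.

Lemma discriminator_weight_exists (V : finType) (H : hypergraph V) :
  exists w, `[< discriminator_weight H w >].
Proof.
pose lambda (v : V) := 2 ^ enum_rank v.
exists (weight lambda); apply/asboolP; exists lambda => //; split=> [E EH|].
  have /set0Pn[v vE] : E != set0.
    by apply: contraNneq (hyperedges_neq0 H) => <-.
  by rewrite (bigD1 v) //= addn_gt0 expn_gt0.
move=> E E' _ _ neqE eq_sum; apply: neqE.
case: (pickP [pred v : V | true]) => [v0 _|V0]; last first.
  by apply/setP=> v; have := V0 v.
have val_nth (i : 'I_#|V|) : nth v0 (enum V) i = enum_val i.
  by rewrite (enum_val_nth v0).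
have sumE (A : {set V}) : \sum_(v in A) lambda v =
    \sum_(i < #|V|) (nth v0 (enum V) i \in A) * 2 ^ i.
  rewrite (reindex enum_rank) /=; last exact/onW_bij/enum_rank_bij.
  rewrite big_mkcond /=; apply: eq_bigr => v _.
  rewrite val_nth enum_rankK.
  by case: (v \in A); rewrite ?mul1n ?mul0n.
move: eq_sum; rewrite !sumE.
move/(@binary_sum_inj _ (fun i => nth v0 (enum V) i \in E)
                        (fun i => nth v0 (enum V) i \in E')) => eqE.
apply/setP=> v; have /= := eqE _ (ltn_ord (enum_rank v)).
by rewrite val_nth enum_rankK.
Qed.

Definition omega0 (V : finType) (H : hypergraph V) : nat :=
  ex_minn (discriminator_weight_exists H).

Lemma omega0P (V : finType) (H : hypergraph V) (w : nat) :
  omega0 H = w <->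
  discriminator_weight H w /\
  (forall lambda : V -> nat, edge_discriminator H lambda -> w <= weight lambda).
Proof.
rewrite /omega0; case: ex_minnP => k /asboolP kH kmin; split=> [<-|[wH wmin]].
  split=> // lambda lambdaH; apply: kmin; apply/asboolP.
  by exists lambda.
apply/eqP; rewrite eqn_leq kmin /=; last exact/asboolP.
by case: kH => lambda lambdaH <-; apply: wmin.
Qed.

(* The vertex v_(i+1) is i : 'I_m, and ordS is the cyclic successor modulo m. *)
Definition cycle_edges (m : nat) : {set {set 'I_m}} :=
  [set [set i; ordS i] | i : 'I_m].

Lemma cycle_edges_neq0 (m : nat) : set0 \notin cycle_edges m.
Proof.
apply/imsetP=> -[i _ /setP/(_ i)].
by rewrite !inE eqxx.
Qed.

Definition cycle_hypergraph (m : nat) : hypergraph 'I_m :=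
  Hypergraph (cycle_edges_neq0 m).

(* Main.v *)
(** Summing the edge labels [lambda i + lambda (i + 1)] around the cycle counts
    every vertex twice, and these labels are m distinct positive integers, so
    twice the weight is at least 1 + ... + m = m(m+1)/2. The weight attains this
    bound, rounded up, when the edge labels are 1, ..., m (for m = 0, 3 mod 4) or
    1, ..., m-1, m+1 (for m = 1, 2 mod 4). Such a labelling for m becomes one for
    m + 4 by splicing four new vertices into the edge entering a vertex labelled
    0: the first new vertex gets 0, so the old edge label survives, and the other
    three are chosen to create the four missing edge labels. *)
Require Import Defs.
From mathcomp Require Import all_boot all_order all_algebra.
From mathcomp Require Import zify lra.

Lemma sumn_iota1 (m : nat) : 2 * sumn (iota 1 m) = m * m.+1.
Proof.
elim: m => // m IHm.
by rewrite -[in iota _ _](addn1 m) iotaD sumn_cat /= mulnDr IHm; lia.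
Qed.

(** The bound [b] is kept apart from [a] so that it rises by exactly one per entry even where the
    path jumps further. *)
Lemma path_ltn_sumn_ge (s : seq nat) (a b : nat) :
  b <= a -> path ltn a s -> sumn (iota b.+1 (size s)) <= sumn s.
Proof.
elim: s a b => //= x s IHs a b le_ba /andP[lt_ax path_s].
have lt_bx : b < x by exact: leq_ltn_trans lt_ax.
exact: leq_add (IHs x b.+1 lt_bx path_s).
Qed.

Lemma uniq_sumn_ge (s : seq nat) :
  uniq s -> 0 \notin s -> sumn (iota 1 (size s)) <= sumn s.
Proof.
move=> uniq_s s0.
have perm_ss : perm_eq (sort leq s) s by rewrite perm_sort.
rewrite -(perm_sumn perm_ss) -(perm_size perm_ss).
apply: (path_ltn_sumn_ge _ 0) => //.
(* Prepending 0 merges positivity and distinctness of the entries into one strict path from 0. *)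
have /= -> := ltn_sorted_uniq_leq (0 :: sort leq s).
rewrite /= mem_sort s0 sort_uniq uniq_s path_min_sorted.
  by rewrite sort_sorted //; exact: leq_total.
exact/allP.
Qed.

Lemma sumn_pairmap_addn (u : seq nat) (a : nat) :
  sumn (pairmap addn a u) + last a u = a + 2 * sumn u.
Proof. by elim: u a => [|x u IHu] a /=; [|have := IHu x]; lia. Qed.

(* Since [last 0 u = 0], [pairmap addn 0 u] lists the sums of cyclically
   consecutive entries of [u]. *)
Lemma cyclic_sums_iota (k m : nat) : m \in [:: 3; 4] ->
  exists u, [/\ size u = m + 4 * k, last 0 u = 0 &
    perm_eq (pairmap addn 0 u) (iota 1 (m + 4 * k))].
Proof.
move=> m34; elim: k => [|k [u [size_u last_u perm_u]]].
  rewrite muln0 addn0; move: m34; rewrite !inE => /orP[] /eqP ->.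
    by exists [:: 1; 2; 0].
  by exists [:: 1; 1; 3; 0].
have -> : m + 4 * k.+1 = m + 4 * k + 4 by lia.
set n := m + 4 * k in size_u perm_u *.
(* After the final 0 of [u], the new sums are n+1, n+2, n+4, n+3. *)
exists (u ++ [:: n.+1; 1; n.+3; 0]).
rewrite size_cat size_u last_cat pairmap_cat last_u iotaD; split=> //.
apply: perm_cat => //; apply/permP => p /=.
rewrite !addnS !addn0 !add0n !add1n.
lia.
Qed.

(** The length N is 1 or 2 modulo 4, so N(N+1)/2 is odd, while the cyclic sums total twice [sumn u]:
    the sums cannot be 1, ..., N, and the largest is raised to N+1. *)
Lemma cyclic_sums_skip (k m : nat) : m \in [:: 4; 5] ->
  exists u, [/\ size u = (m + 4 * k).+1, last 0 u = 0 &
    perm_eq (pairmap addn 0 u) (rcons (iota 1 (m + 4 * k)) (m + 4 * k).+2)].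
Proof.
move=> m45; elim: k => [|k [u [size_u last_u perm_u]]].
  rewrite muln0 addn0; move: m45; rewrite !inE => /orP[] /eqP ->.
    by exists [:: 1; 1; 2; 4; 0].
  by exists [:: 1; 1; 2; 3; 4; 0].
have -> : m + 4 * k.+1 = m + 4 * k + 4 by lia.
set n := m + 4 * k in size_u perm_u *.
(* The new sums n+1, n+3, n+6, n+4 fill in around the old top label n+2 and leave n+5 as the only
   gap. *)
exists (u ++ [:: n.+1; 2; n.+4; 0]).
rewrite size_cat size_u last_cat pairmap_cat last_u iotaD; split=> //.
apply/permP => p; move/permP/(_ p): perm_u.
rewrite -!cats1 !count_cat => -> /=.
rewrite !addnS !addn0 !add0n !add1n add2n.
lia.
Qed.

Lemma exists_cyclic_labels (m : nat) : 3 <= m ->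
  exists u, [/\ size u = m, last 0 u = 0, uniq (pairmap addn 0 u),
    0 \notin pairmap addn 0 u &
    2 * sumn (pairmap addn 0 u) <= m * m.+1 + 2].
Proof.
move=> m3.
have [k [r [r34 [-> | ->]]]] : exists k r, r \in [:: 3; 4] /\
    (m = r + 4 * k \/ m = (r.+1 + 4 * k).+1).
  have := divn_eq (m - 3) 4; have := ltn_pmod (m - 3) (isT : 0 < 4).
  (* The quotient counts the splices; parity selects the base case. *)
  exists ((m - 3) %/ 4), (3 + odd (m - 3)); split.
    by case: (odd _).
  lia.
- have [u [size_u last_u perm_u]] := cyclic_sums_iota k _ r34.
  exists u; rewrite (perm_uniq perm_u) (perm_mem perm_u) (perm_sumn perm_u).
  split=> //; first exact: iota_uniq.
    by rewrite mem_iota.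
  by rewrite sumn_iota1 leq_addr.
- have r45 : r.+1 \in [:: 4; 5] by move: r34; rewrite !inE !eqSS.
  have [u [size_u last_u perm_u]] := cyclic_sums_skip k _ r45.
  exists u; rewrite (perm_uniq perm_u) (perm_mem perm_u) (perm_sumn perm_u).
  split=> //.
  + by rewrite rcons_uniq iota_uniq mem_iota; lia.
  + by rewrite mem_rcons inE mem_iota.
  by rewrite sumn_rcons mulnDr sumn_iota1; lia.
Qed.

Lemma val_ordS (m : nat) (i : 'I_m) :
  ordS i = (if i.+1 == m then 0 else i.+1) :> nat.
Proof.
have lt_im := ltn_ord i; rewrite /=.
by have [->|neq_im] := eqVneq i.+1 m; rewrite ?modnn // modn_small //; lia.
Qed.

Lemma ordS_neq (m : nat) (i : 'I_m) : 2 <= m -> ordS i != i.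
Proof.
move=> m2; apply/eqP => /(congr1 (@nat_of_ord m)); rewrite val_ordS.
by case: eqP; lia.
Qed.

(** Two equal edges with different first vertices would make [ordS] swap these vertices, which
    forces m = 2. *)
Lemma cycle_edge_inj (m : nat) :
  3 <= m -> injective (fun i : 'I_m => [set i; ordS i]).
Proof.
move=> m3 i j eq_ij.
have : i \in [set j; ordS j] by rewrite -eq_ij !inE eqxx.
have : ordS i \in [set j; ordS j] by rewrite -eq_ij !inE eqxx orbT.
rewrite !inE => /orP[/eqP eqj | /eqP /ordS_inj //] /orP[/eqP //|/eqP eqi].
move: eqj; rewrite eqi => /(congr1 (@nat_of_ord m)); rewrite !val_ordS.
by do 2!case: eqP; lia.
Qed.

Section CycleLabels.

Variables (m : nat) (lambda : 'I_m -> nat).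
Hypothesis m3 : 3 <= m.

Let label (i : 'I_m) := lambda i + lambda (ordS i).

Lemma sum_cycle_edge (i : 'I_m) : \sum_(v in [set i; ordS i]) lambda v = label i.
Proof.
by rewrite big_setU1 ?big_set1 // inE eq_sym ordS_neq // ltnW.
Qed.

Lemma edge_discriminator_cycle :
  edge_discriminator (cycle_hypergraph m) lambda <->
  (forall i, 0 < label i) /\ injective label.
Proof.
split=> [[pos inj]|[pos inj]]; split.
- by move=> i; rewrite -sum_cycle_edge; apply: pos; apply: imset_f.
- move=> i j eq_ij; apply/eqP/negP => /negP neq_ij.
  apply: (inj [set i; ordS i] [set j; ordS j]); try exact: imset_f.
    by move/(cycle_edge_inj m m3)/eqP; rewrite (negPf neq_ij).
  by rewrite !sum_cycle_edge.
- by move=> E /imsetP[i _ ->]; rewrite sum_cycle_edge.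
move=> E E' /imsetP[i _ ->] /imsetP[j _ ->] neqE; rewrite !sum_cycle_edge.
by move=> /inj eq_ij; apply: neqE; rewrite eq_ij.
Qed.

Lemma sum_label : \sum_i label i = 2 * weight lambda.
Proof.
rewrite big_split /= mul2n -addnn; congr (_ + _).
by rewrite [RHS](reindex (@ordS m)) //; exact/onW_bij/ordS_bij.
Qed.

Lemma cycle_weight_ge :
  edge_discriminator (cycle_hypergraph m) lambda -> m * m.+1 <= 4 * weight lambda.
Proof.
move=> /edge_discriminator_cycle[pos inj].
rewrite -(mulnA 2 2) -sum_label -sumn_iota1 leq_mul2l /=.
have -> : \sum_i label i = sumn (codom label).
  by rewrite sumnE big_map big_enum.
have {1}-> : m = size (codom label) by rewrite size_codom card_ord.
apply: uniq_sumn_ge; first exact/injectiveP.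
by apply/codomP => -[i eq0]; have := pos i; rewrite -eq0.
Qed.

End CycleLabels.

Lemma exists_cycle_discriminator (m : nat) : 3 <= m ->
  exists2 lambda, edge_discriminator (cycle_hypergraph m) lambda &
    4 * weight lambda <= m * m.+1 + 2.
Proof.
move=> m3; have [u [size_u last_u uniq_u u0 sum_u]] := exists_cyclic_labels _ m3.
pose s := pairmap addn 0 u.
have size_s : size s = m by rewrite size_pairmap.
pose lambda (i : 'I_m) := nth 0 u i.
(* Entry j of [s] adds entries j-1 and j of [u], hence the index [ordS i]; at j = 0 the seed 0
   stands for the last entry of [u]. *)
have labelE (i : 'I_m) : lambda i + lambda (ordS i) = nth 0 s (ordS i).
  rewrite (nth_pairmap 0) ?size_u ?ltn_ord //; congr (_ + _).
  rewrite /lambda val_ordS.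
  case: eqP => //= eq_im; rewrite -[RHS]last_u -nth_last size_u.
  by congr nth; lia.
have weightE : weight lambda = sumn u.
  by rewrite sumnE (big_nth 0) size_u big_mkord.
exists lambda.
  apply/(edge_discriminator_cycle _ _ m3); split=> [i|i j].
    rewrite labelE lt0n; apply: contraNneq u0 => eq0.
    by rewrite -[X in X \in _]eq0 mem_nth // size_s.
  rewrite !labelE => /eqP; rewrite nth_uniq ?size_s ?ltn_ord //.
  by move/eqP/val_inj/ordS_inj.
have := sumn_pairmap_addn u 0; rewrite last_u weightE.
by lia.
Qed.

Theorem theorem1p3 (m : nat) (hm : (3 <= m)%N) :
  Posz (omega0 (cycle_hypergraph m)) =
  Num.ceil ((m * m.+1)%:R / 4%:R : rat)%R.
Proof.
have /omega0P := erefl (omega0 (cycle_hypergraph m)).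
set w := omega0 _ => -[[lambda disc_lambda weight_lambda] w_min].
have lb := cycle_weight_ge _ _ hm disc_lambda.
have [mu disc_mu ub] := exists_cycle_discriminator m hm.
have le_w := w_min mu disc_mu.
rewrite weight_lambda in lb.
have {}ub : 4 * w <= m * m.+1 + 2 by apply: leq_trans ub; rewrite leq_mul2l.
(* What remains is w - 1 < m(m+1)/4 <= w; the slack 2 in [ub] is below 4. *)
apply/esym/Num.Theory.ceil_def.
rewrite GRing.rmorphB /= -pmulrn.
move: lb ub; rewrite -!(@Num.Theory.ler_nat rat) (GRing.natrM _ 4) GRing.natrD => lb ub.
by apply/andP; split; lra.
Qed.
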